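(* Fix a polynomial $\sigma$. There exist constants $c>0$ and $d_0\in\mathbb{N}$ (depending only on $\sigma$) such that the following holds. For each odd $d\in\mathbb{N}$ there exist formulations of nonempty polytopes $P_1,P_2\subseteq\mathbb{R}^d$, of size $f_1$ and $f_2$ respectively, such that any formulation of $\operatorname{conv}(P_1\cup P_2)$ of size at most $\sigma(f_1+f_2)$ has $\Omega(d)$ additional variables, i.e. has at least $c\,d$ additional variables whenever $d\ge d_0$.
   Context: For a set $X$, $\operatorname{conv}(X)$ is its convex hull. Given a polytope $P\subseteq\mathbb{R}^d$, a polytope $Q\subseteq\mathbb{R}^{d+m}$ (with $m\ge 0$) is a linear extension of $P$ with $m$ additional variables if $P=\operatorname{proj}_x(Q):=\{x\in\mathbb{R}^d:\exists\,y\in\mathbb{R}^m\text{ such that }(x,y)\in Q\}$; the case $Q=P$ ($m=0$) is allowed. A formulation of $P$ is a (finite) system of linear inequalities describing a linear extension $Q$ of $P$; its size is the number of inequalities in the system, and its number of additional variables is $m$. *)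

(* Defs.v *)
From mathcomp Require Import all_boot all_order all_algebra.
From mathcomp Require Import boolp classical_sets cardinality reals convex.

Set Implicit Arguments.
Unset Strict Implicit.
Unset Printing Implicit Defensive.

Import Order.TTheory GRing.Theory Num.Theory.

Local Open Scope classical_set_scope.
Local Open Scope ring_scope.

Definition convex_hull (R : realType) (n : nat) (X : set 'cV[R]_n) :
  set 'cV[R]_n := smallest (@convex_set R 'cV[R]_n) X.

Definition polytope (R : realType) (n : nat) (P : set 'cV[R]_n) : Prop :=
  exists V : set 'cV[R]_n, finite_set V /\ P = convex_hull V.

Definition polyhedron (R : realType) (k n : nat)
    (A : 'M[R]_(k, n)) (b : 'cV[R]_k) : set 'cV[R]_n :=
  [set z | forall i : 'I_k, (A *m z) i 0 <= b i 0].

(* [col_mx x y] is the point (x, y) of R^(d + m). *)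
Definition proj_x (R : realType) (d m : nat) (Q : set 'cV[R]_(d + m)) :
  set 'cV[R]_d := [set x | exists y : 'cV[R]_m, Q (col_mx x y)].

Definition linear_extension (R : realType) (d m : nat)
    (P : set 'cV[R]_d) (Q : set 'cV[R]_(d + m)) : Prop :=
  polytope Q /\ P = proj_x Q.

(* The size is the number of rows of the system, so it counts redundant or
   repeated inequalities, and an equation counts as two inequalities. *)
Record formulation (R : realType) (d : nat) (P : set 'cV[R]_d) := Formulation {
  form_vars : nat;
  form_size : nat;
  form_mx : 'M[R]_(form_size, d + form_vars);
  form_rhs : 'cV[R]_form_size;
  form_ext : linear_extension P (polyhedron form_mx form_rhs)
}.

(* Main.v *)
Require Import Defs.
From mathcomp Require Import all_boot all_order all_algebra.
From mathcomp Require Import boolp classical_sets cardinality reals convex.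
From mathcomp Require Import interval_inference ring lra zify.

Set Implicit Arguments.
Unset Strict Implicit.
Unset Printing Implicit Defensive.

Import Order.TTheory GRing.Theory Num.Theory.

Local Open Scope classical_set_scope.
Local Open Scope ring_scope.

(** Polynomially many inequalities in a space with few additional variables
can only produce polynomially many facets.  Let [P] be the projection of a
polytope [Q] with [f] inequalities and [m] additional variables.  The points of
[Q] above a facet of [P] contain [d] affinely independent points of [R^(d + m)],
so the inequalities of [Q] that are tight on all of them have rank at most
[m + 1] once homogenised, and by optimality the inequality of the facet is a
linear combination of the tight ones.  Hence [m + 1] inequalities of [Q]
determine the facet ([face_code]), and [P] has at most [(f + 1) ^ (m + 1)]
facets ([card_facets_formulation]).

It remains to find two polytopes with few inequalities whose union has a hull
with many facets.  Write [d = 2 k + 1] and use coordinates [(x, y, t)] with [x]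
and [y] in [R^k].  Let [P1] lie in the hyperplane [t = 0] and be the product of
[k] copies of a polygon whose upper boundary is made of [n] tangents
[y + 2 j x = j ^ 2] of the parabola [y = - x ^ 2], and let [P2] lie in [t = 1]
and be the simplex with vertices [0] and the unit vectors of the [y]-space.  For
each choice [J] of one upper edge per polygon, the functional
[\sum_i (2 J_i x_i + y_i)] is maximal on [P1] exactly on the product of these
edges, a [k]-dimensional face, and is maximal on [P2] on the [k] unit vectors,
because all tangents are normalised to have [y]-coefficient 1.  Adding a
suitable multiple of [t] makes the two maxima agree, and the [k + 1] plus [k]
points span a facet of the hull.  So [n ^ k] facets come from [O(k n)]
inequalities ([parabola_corner_union]).

The number [n] is free.  For [n] large, a formulation of size at most
[sigma (f1 + f2)] has [f + 1 <= n ^ e], where [e] depends on [sigma] only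
([polynomially_bounded_size]); then [n ^ k <= n ^ (e (m + 1))] bounds [m] below
by a linear function of [d]. *)

(** * Convex sets and bounded polyhedra *)

Lemma convexP (R : realType) (n : nat) (X : set 'cV[R]_n) :
  @convex_set R 'cV[R]_n X <->
  forall x y l, X x -> X y -> 0 <= l <= 1 -> X (l *: x + (1 - l) *: y).
Proof.
split=> [cX x y l Xx Xy /andP[l0 l1]|cX x y l].
  have := cX x y (Itv01 l0 l1).
  by rewrite !inE; apply.
rewrite !inE => Xx Xy.
by apply: (cX x y l%:num) => //; rewrite ge0 le1.
Qed.

Lemma convex_hull_convex (R : realType) (n : nat) (X : set 'cV[R]_n) :
  @convex_set R 'cV[R]_n (convex_hull X).
Proof.
apply/convexP => x y l Xx Xy l01 Y [cY sXY].
by move/convexP: (cY); apply => //; [apply: Xx|apply: Xy].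
Qed.

Lemma convex_halfspace (R : realType) (n : nat) (c : 'rV[R]_n) (h : R) :
  @convex_set R 'cV[R]_n [set z | (c *m z) 0 0 <= h].
Proof.
apply/convexP => x y l /= cx cy /andP[l0 l1].
by rewrite mulmxDr -!scalemxAr !mxE in cx cy *; nra.
Qed.

Lemma convex_polyhedron (R : realType) (k n : nat)
  (A : 'M[R]_(k, n)) (b : 'cV[R]_k) : @convex_set R 'cV[R]_n (polyhedron A b).
Proof.
apply/convexP => x y l Ax Ay l01 i.
have rowE z : (A *m z) i 0 = (row i A *m z) 0 0 by rewrite -row_mul [RHS]mxE.
have /convexP cH := @convex_halfspace R n (row i A) (b i 0).
by rewrite rowE; apply: (cH x y l) => //=; rewrite -rowE; [exact: Ax|exact: Ay].
Qed.

Definition tight (R : realType) (k n : nat) (A : 'M[R]_(k, n)) (b : 'cV[R]_k)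
  (z : 'cV[R]_n) : {set 'I_k} := [set i | (A *m z) i 0 == b i 0].

Definition bounded (R : realType) (n : nat) (X : set 'cV[R]_n) :=
  exists N : R, forall z, X z -> forall i, `|z i 0| <= N.

(** Moving along [w] keeps the tight inequalities tight, and boundedness forces
the ray to stop; the inequality that stops it is a new tight one. *)
Lemma exit_bounded_polyhedron (R : realType) (k n : nat) (A : 'M[R]_(k, n))
    (b : 'cV[R]_k) (z w : 'cV[R]_n) :
  bounded (polyhedron A b) -> polyhedron A b z -> w != 0 ->
  (forall i, i \in tight A b z -> (A *m w) i 0 = 0) ->
  exists s, [/\ 0 < s, polyhedron A b (z + s *: w) &
    tight A b z \proper tight A b (z + s *: w)].
Proof.
move=> [N bN] Qz w0 wT.
have AE s i : (A *m (z + s *: w)) i 0 = (A *m z) i 0 + s * (A *m w) i 0.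
  by rewrite mulmxDr -scalemxAr !mxE.
(* Otherwise the whole ray stays in the polyhedron. *)
have [i0 wi0] : exists i, 0 < (A *m w) i 0.
  apply: contrapT => noi.
  have Qs s : 0 <= s -> polyhedron A b (z + s *: w).
    move=> s0 i; rewrite AE; have := Qz i.
    have : ~ 0 < (A *m w) i 0 by move=> wi; apply: noi; exists i.
    by move/negP; rewrite -leNgt; nra.
  have [j wj] : exists j, w j 0 != 0.
    apply/existsP; apply: contraNT w0; rewrite negb_exists => /forallP w0.
    by apply/eqP/colP => j; rewrite mxE; apply/eqP; have := w0 j; rewrite negbK.
  have wj0 : 0 < `|w j 0| by rewrite normr_gt0.
  have N0 : 0 <= N by apply: le_trans (bN _ Qz j).
  have s0 : 0 <= (N + N + 1) / `|w j 0| by rewrite divr_ge0//; lra.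
  have := bN _ (Qs _ s0) j; rewrite !mxE.
  have := bN _ Qz j.
  set s := _ / _ => zN zsN.
  have : `|s * w j 0| = N + N + 1.
    rewrite normrM (ger0_norm s0) /s mulfVK//; exact: lt0r_neq0.
  have : `|s * w j 0| <= `|z j 0 + s * w j 0| + `|z j 0|.
    rewrite -[X in `|X| <= _](addrK (z j 0)) (addrC (_ * _)).
    exact: ler_normB.
  lra.
(* [t i] is the time at which the ray meets the [i]-th inequality. *)
pose t i := (b i 0 - (A *m z) i 0) / (A *m w) i 0.
have [i1 wi1 tmin] := @arg_minP _ R _ i0 (fun i => 0 < (A *m w) i 0) t wi0.
have i1T : i1 \notin tight A b z.
  by apply/negP => /wT wi; rewrite wi ltxx in wi1.
have bi1 : (A *m z) i1 0 < b i1 0.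
  by rewrite lt_neqAle Qz andbT; move: i1T; rewrite inE.
have t0 : 0 < t i1 by rewrite divr_gt0// subr_gt0.
exists (t i1); split => //.
  move=> i; rewrite AE; have := Qz i.
  have [wi|wi] := ltP 0 ((A *m w) i 0); last by nra.
  move=> _; have := tmin i wi.
  rewrite {2}/t ler_pdivlMr//; lra.
apply/properP; split.
  apply/fintype.subsetP => i iT; rewrite inE AE wT// mulr0 addr0.
  by move: iT; rewrite inE.
exists i1 => //; rewrite inE AE /t mulfVK ?lt0r_neq0//.
by apply/eqP; ring.
Qed.

(** The Minkowski-Weyl theorem in the direction needed to exhibit polytopes by
inequalities.  The vertices are the points determined by their tight
inequalities, so there are at most as many as sets of inequalities.  A point
that is not a vertex lies between the two exits of a line along which its tight
inequalities stay tight, and both exits have more tight inequalities. *)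
Lemma bounded_polyhedron_polytope (R : realType) (k n : nat)
    (A : 'M[R]_(k, n)) (b : 'cV[R]_k) :
  bounded (polyhedron A b) -> polytope (polyhedron A b).
Proof.
move=> bQ.
pose V := [set v | polyhedron A b v /\ forall z,
  (forall i, i \in tight A b v -> (A *m z) i 0 = b i 0) -> z = v].
exists V; split.
  pose g (T : {set 'I_k}) := xget 0 [set v | V v /\ tight A b v = T].
  apply: (@sub_finite_set _ _ (g @` setT)); last first.
    by apply: finite_image; apply: finite_finset.
  move=> v Vv; exists (tight A b v) => //.
  have [] : [set u | V u /\ tight A b u = tight A b v] (g (tight A b v)).
    by apply: xgetPex; exists v.
  move=> _ Tg; by apply: Vv.2 => i; rewrite -{1}Tg inE => /eqP.
apply/seteqP; split; last first.
  by apply: smallest_sub; [exact: convex_polyhedron|move=> v []].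
move=> z.
have [m] := ubnP #|~: tight A b z|; elim: m z => // m IH z zm Qz.
have [Vz|nVz] := pselect (V z); first exact: sub_gen_smallest.
have [w [w0 wT]] : exists w : 'cV[R]_n, w != 0 /\
    forall i, i \in tight A b z -> (A *m w) i 0 = 0.
  apply: contrapT => now; apply: nVz; split => // u uT.
  apply/eqP; rewrite -subr_eq0; apply: contrapT => /negP uz.
  apply: now; exists (u - z); split => // i iT.
  rewrite mulmxBr [LHS]mxE [X in _ + X]mxE uT//.
  by move: iT; rewrite inE => /eqP ->; rewrite subrr.
have hull u : polyhedron A b u -> tight A b z \proper tight A b u ->
    convex_hull V u.
  move=> Qu Tu; apply: IH => //; rewrite ltnS in zm.
  apply: leq_trans zm; apply: proper_card.
  by rewrite properC.
have [s [s0 Qs Ts]] := exit_bounded_polyhedron bQ Qz w0 wT.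
have [s' [s'0 Qs' Ts']] : exists s, [/\ 0 < s, polyhedron A b (z + s *: - w) &
    tight A b z \proper tight A b (z + s *: - w)].
  apply: exit_bounded_polyhedron => //; first by rewrite oppr_eq0.
  by move=> i /wT; rewrite mulmxN !mxE => ->; rewrite oppr0.
have ss0 : 0 < s + s' by lra.
have -> : z = (s' / (s + s')) *: (z + s *: w) +
    (1 - s' / (s + s')) *: (z + s' *: - w).
  apply/colP => i; rewrite !mxE; field; exact: lt0r_neq0.
have /convexP := @convex_hull_convex R n V.
apply; [exact: hull|exact: hull|].
rewrite ler_pdivrMr// mul1r divr_ge0 ?ltW//=; lra.
Qed.

(** * Formulations without additional variables *)

Lemma bounded_polyhedron_formulation (R : realType) (k n : nat)
    (A : 'M[R]_(k, n)) (b : 'cV[R]_k) :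
  bounded (polyhedron A b) ->
  exists F : formulation (polyhedron A b), form_size F = k.
Proof.
move=> bQ.
have rowE (x : 'cV[R]_n) (y : 'cV[R]_0) :
    row_mx A (0 : 'M_(k, 0)) *m col_mx x y = A *m x.
  by rewrite mul_row_col mul0mx addr0.
have ext : linear_extension (polyhedron A b)
    (polyhedron (row_mx A (0 : 'M_(k, 0))) b).
  split; last first.
    apply/seteqP; split=> [x Px|x [y Py]].
      by exists 0 => i; rewrite rowE; apply: Px.
    by move=> i; have := Py i; rewrite rowE.
  apply: bounded_polyhedron_polytope; have [N bN] := bQ; exists N => z Qz i.
  rewrite -(vsubmxK z); case: (split_ordP i) => [j ->|[]//].
  rewrite col_mxEu; apply: bN => j'.
  by have := Qz j'; rewrite -{1}(vsubmxK z) rowE.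
by exists (Formulation ext).
Qed.

(** The explicit bounds make the boundedness of the polyhedron immediate; equal
lower and upper bounds fix a coordinate. *)
Definition boxed (R : realType) (d : nat) (I : finType) (l u : 'cV[R]_d)
  (a : I -> 'rV[R]_d) (h : I -> R) : set 'cV[R]_d :=
  [set x : 'cV[R]_d | (forall i, l i 0 <= x i 0 <= u i 0) /\
           forall i, (a i *m x) 0 0 <= h i].

Lemma boxed_formulation (R : realType) (d : nat) (I : finType)
    (l u : 'cV[R]_d) (a : I -> 'rV[R]_d) (h : I -> R) :
  polytope (boxed l u a h) /\
  exists F : formulation (boxed l u a h), form_size F = (d + d + #|I|)%N.
Proof.
pose A := col_mx (col_mx (1%:M : 'M[R]_d) (- 1%:M))
  (\matrix_(i < #|I|) a (enum_val i)).
pose b := col_mx (col_mx u (- l)) (\col_(i < #|I|) h (enum_val i)).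
have AE (x : 'cV_d) : A *m x = col_mx (col_mx x (- x))
    (\col_(i < #|I|) (a (enum_val i) *m x) 0 0).
  rewrite !mul_col_mx mul1mx mulNmx mul1mx; congr col_mx.
  apply/colP => i; rewrite [RHS]mxE !mxE.
  by apply: eq_bigr => j _; rewrite !mxE.
have -> : boxed l u a h = polyhedron A b.
  apply/seteqP; split=> [x [lux ax] i|x Px].
    rewrite AE /b; case: (split_ordP i) => [j ->|j ->].
      rewrite !col_mxEu; case: (split_ordP j) => [j' ->|j' ->].
        by rewrite !col_mxEu; have /andP[] := lux j'.
      by rewrite !col_mxEd !mxE lerN2; have /andP[] := lux j'.
    by rewrite !col_mxEd [X in X <= _]mxE [X in _ <= X]mxE; apply: ax.
  split=> i.
    apply/andP; split.
      have := Px (lshift _ (rshift _ i)).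
      by rewrite AE /b !col_mxEu !col_mxEd !mxE lerN2.
    by have := Px (lshift _ (lshift _ i)); rewrite AE /b !col_mxEu.
  have := Px (rshift _ (enum_rank i)).
  by rewrite AE /b !col_mxEd [X in X <= _]mxE [X in _ <= X]mxE enum_rankK.
have bQ : bounded (polyhedron A b).
  exists (\sum_i (`|l i 0| + `|u i 0|)) => x Px i.
  rewrite (bigD1 i)//=; set rest := \sum_(j | _) _.
  have : 0 <= rest.
    by apply: sumr_ge0 => j _; rewrite addr_ge0.
  have := Px (lshift _ (rshift _ i)).
  rewrite AE /b !col_mxEu !col_mxEd !mxE lerN2.
  have := Px (lshift _ (lshift _ i)); rewrite AE /b !col_mxEu.
  have := ler_norm (u i 0); have := ler_norm (- l i 0); rewrite normrN.
  have := normr_ge0 (u i 0); have := normr_ge0 (l i 0).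
  by rewrite ler_norml => *; apply/andP; split; lra.
split; first exact: bounded_polyhedron_polytope.
exact: bounded_polyhedron_formulation.
Qed.

(** * The number of facets of a projection *)

Lemma small_step (R : realType) (k : nat) (s v : 'I_k -> R) :
  exists2 e : R, 0 < e & forall i, 0 < s i -> e * v i <= s i.
Proof.
pose S := 1 + \sum_(i | 0 < s i) `|v i| / s i.
have t0 i : 0 < s i -> 0 <= `|v i| / s i by move=> ?; rewrite divr_ge0// ltW.
have S0 : 0 < S by rewrite ltr_pwDl// sumr_ge0.
(* [S] exceeds every ratio between a speed [`|v i|] and a slack [s i]. *)
exists S^-1; first by rewrite invr_gt0.
move=> i si; rewrite mulrC ler_pdivrMr//.
have : `|v i| / s i <= S.
  rewrite /S (bigD1 i)//= addrCA ler_wpDr// ?addr_ge0// sumr_ge0//.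
  by move=> j /andP[/t0].
rewrite ler_pdivrMr// mulrC; apply: le_trans; exact: ler_norm.
Qed.

Definition affinely_independent (R : realType) (n : nat) (S : finType)
    (z : S -> 'cV[R]_n) :=
  forall u : S -> R, \sum_s u s = 0 -> \sum_s u s *: z s = 0 ->
    forall s, u s = 0.

(** This replaces linear programming duality by orthogonality: a functional that
is not in the span of the tight rows increases along some direction orthogonal
to them, and a small step in that direction stays in the polyhedron. *)
Lemma face_functional_in_span (R : realType) (k n : nat) (A : 'M[R]_(k, n))
    (b : 'cV[R]_k) (C : 'rV[R]_n) (h : R) (z : 'cV[R]_n) (T : {set 'I_k}) :
  polyhedron A b z -> (forall i, i \notin T -> (A *m z) i 0 < b i 0) ->
  (forall i, i \in T -> (A *m z) i 0 = b i 0) ->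
  (forall x, polyhedron A b x -> (C *m x) 0 0 <= h) -> (C *m z) 0 0 = h ->
  (C <= \matrix_(i < #|T|) row (enum_val i) A)%MS.
Proof.
move=> Qz zT Tz CQ Cz; set AT := \matrix_(i < _) _.
suff CW (w : 'cV_n) : AT *m w = 0 -> (C *m w) 0 0 <= 0.
  rewrite submxE; apply/eqP/rowP => j; rewrite [RHS]mxE.
  have colM m (B : 'M_(m, n)) (K : 'M_n) : B *m col j K = col j (B *m K).
    by rewrite !colE mulmxA.
  have jE : (C *m cokermx AT) 0 j = (C *m col j (cokermx AT)) 0 0.
    by rewrite colM [RHS]mxE.
  have Aw0 : AT *m col j (cokermx AT) = 0.
    by rewrite colM mulmx_coker colE mul0mx.
  apply/le_anti; rewrite jE CW//= -oppr_le0.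
  have := CW (- col j (cokermx AT)).
  rewrite !mulmxN Aw0 oppr0 => /(_ erefl).
  by rewrite mxE.
move=> Aw0.
have Tw i : i \in T -> (A *m w) i 0 = 0.
  move=> iT; have /colP/(_ (enum_rank_in iT i)) := Aw0.
  rewrite [RHS]mxE => <-; rewrite !mxE; apply: eq_bigr => j _.
  by rewrite !mxE enum_rankK_in.
have [e e0 ew] := small_step (fun i => b i 0 - (A *m z) i 0)
  (fun i => (A *m w) i 0).
have Qe : polyhedron A b (z + e *: w).
  move=> i; rewrite mulmxDr -scalemxAr [X in X <= _]mxE [X in _ + X]mxE.
  have [iT|iT] := boolP (i \in T); first by rewrite Tw// mulr0 addr0.
  by have := ew i; rewrite subr_gt0 => /(_ (zT i iT)); lra.
have := CQ _ Qe; rewrite mulmxDr -scalemxAr [X in X <= _]mxE [X in _ + X]mxE Cz.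
by rewrite gerDl pmulr_rle0.
Qed.

(** A face containing many affinely independent points is cut out by few rows of
the system.  The code [e] lists these rows; [None] pads the list when the rank
is smaller than [r].  The rows are taken from the homogenised system [(A | b)]
restricted to the rows tight at every [z s]: the vectors [(z s, -1)] are
independent and in its kernel, so its rank is at most [n + 1 - #|S|].  The
barycenter of the [z s] has no other tight row, which puts [(C | h)] in the row
space. *)
Lemma face_code (R : realType) (k n r : nat) (A : 'M[R]_(k, n))
    (b : 'cV[R]_k) (C : 'rV[R]_n) (h : R) (S : finType) (z : S -> 'cV[R]_n) :
  (forall x, polyhedron A b x -> (C *m x) 0 0 <= h) ->
  (forall s, polyhedron A b (z s)) -> (forall s, (C *m z s) 0 0 = h) ->
  affinely_independent z -> (0 < #|S|)%N -> (n.+1 <= #|S| + r)%N ->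
  exists e : {ffun 'I_r -> option 'I_k},
    (forall s a i, e a = Some i -> (A *m z s) i 0 = b i 0) /\
    forall x : 'cV[R]_n, (forall a i, e a = Some i -> (A *m x) i 0 = b i 0) ->
      (C *m x) 0 0 = h.
Proof.
move=> CQ Qz Cz indep S0 nS.
pose T := [set i | [forall s, (A *m z s) i 0 == b i 0]]%SET.
have Tz s i : i \in T -> (A *m z s) i 0 = b i 0.
  by rewrite inE => /forallP/(_ s)/eqP.
pose AB := row_mx A b.
pose pt (x : 'cV[R]_n) : 'cV[R]_(n + 1) := col_mx x (-1)%:M.
have hom x i : (AB *m pt x) i 0 = (A *m x) i 0 - b i 0.
  by rewrite mul_row_col mul_mx_scalar scaleN1r mxE [X in _ + X]mxE.
pose M := \matrix_(i < #|T|) row (enum_val i) AB.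
pose Z := \matrix_(i < #|S|) (pt (z (enum_val i)))^T.
have sumS (V : zmodType) (g : S -> V) :
    \sum_s g s = \sum_(i < #|S|) g (enum_val i).
  by rewrite (reindex _ (onW_bij _ (@enum_val_bij S))).
have rZ : \rank Z = #|S|.
  apply/eqP/inj_row_free => v vZ.
  have vE j : \sum_i v 0 i * pt (z (enum_val i)) j 0 = 0.
    transitivity ((v *m Z) 0 j); last by rewrite vZ mxE.
    rewrite [RHS]mxE.
    by apply: eq_bigr => i _; congr (_ * _); rewrite [RHS]mxE [RHS]mxE.
  apply/rowP => i; rewrite mxE -[i]enum_valK.
  apply: (indep (fun s => v 0 (enum_rank s))) => /=; rewrite sumS.
    have := vE (rshift n ord0).
    under eq_bigr => i' _ do rewrite col_mxEd mxE eqxx mulr1n mulrN1.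
    rewrite sumrN => /eqP; rewrite oppr_eq0 => /eqP => v0.
    by under eq_bigr => i' _ do rewrite enum_valK.
  apply/colP => j; rewrite [RHS]mxE summxE; apply: etrans (vE (lshift 1 j)).
  by apply: eq_bigr => i' _; rewrite col_mxEu mxE enum_valK.
have rM : (\rank M <= r)%N.
  have : Z *m M^T = 0.
    apply/matrixP => s a; rewrite [RHS]mxE.
    transitivity ((AB *m pt (z (enum_val s))) (enum_val a) 0).
      by rewrite mxE [RHS]mxE; apply: eq_bigr => j _; rewrite mulrC !mxE.
    by rewrite hom Tz ?enum_valP// subrr.
  move/mulmx0_rank_max; rewrite rZ mxrank_tr; lia.
have [D CM] : exists D, row_mx C h%:M = D *m M.
  pose AT := \matrix_(i < #|T|) row (enum_val i) A.
  pose zbar := #|S|%:R^-1 *: \sum_s z s.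
  have S0R : 0 < #|S|%:R :> R by rewrite ltr0n.
  have avg m (B : 'M_(m, n)) i :
      (B *m zbar) i 0 = #|S|%:R^-1 * \sum_s (B *m z s) i 0.
    by rewrite -scalemxAr mulmx_sumr mxE summxE.
  have avgc (g : R) : #|S|%:R^-1 * \sum_(s : S) g = g.
    by rewrite sumr_const -[X in _ * X]mulr_natl mulKf// lt0r_neq0.
  have /submxP[D CD] : (C <= AT)%MS.
    apply: (@face_functional_in_span _ _ _ A b C h zbar T) => //.
    - move=> i; rewrite avg -(avgc (b i 0)) ler_wpM2l ?invr_ge0 ?ler0n//.
      by apply: ler_sum => s _; apply: Qz.
    - move=> i; rewrite inE negb_forall => /existsP[s0 zs0].
      rewrite avg -[ltRHS](avgc (b i 0)) ltr_pM2l ?invr_gt0//.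
      rewrite (bigD1 s0)//= [ltRHS](bigD1 s0)//= ltr_leD//.
        by rewrite lt_neqAle zs0 Qz.
      by apply: ler_sum => s _; apply: Qz.
    - move=> i iT; rewrite avg -[RHS]avgc; congr (_ * _).
      by apply: eq_bigr => s _; apply: Tz.
    - by rewrite avg -[RHS]avgc; congr (_ * _); apply: eq_bigr.
  exists D; have /card_gt0P[s _] := S0.
  have -> : M = row_mx AT (AT *m z s).
    apply/row_matrixP => a; rewrite rowK row_row_mx row_row_mx row_mul rowK.
    rewrite -row_mul; congr row_mx; apply/rowP => j.
    by rewrite ord1 !mxE -[LHS](Tz s) ?enum_valP// mxE.
  rewrite mul_mx_row mulmxA -CD; congr row_mx.
  by rewrite [RHS]mx11_scalar Cz.
pose e : {ffun 'I_r -> option 'I_k} :=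
  [ffun a => omap (fun j => enum_val (maxrankfun M j)) (insub (val a))].
exists e; split.
  move=> s a i; rewrite ffunE; case: insub => //= j [<-].
  by apply: Tz; apply: enum_valP.
move=> x ex.
have Mx : M *m pt x = 0.
  have /submxP[D' MD'] : (M <= rowsub (maxrankfun M) M)%MS.
    by rewrite eq_maxrowsub.
  rewrite [X in X *m _]MD' -mulmxA.
  suff -> : rowsub (maxrankfun M) M *m pt x = 0 by rewrite mulmx0.
  apply/row_matrixP => j; rewrite row_mul row_rowsub rowK -row_mul row0.
  apply/rowP => j'; rewrite ord1 mxE hom [RHS]mxE.
  have jr : (j < r)%N by apply: leq_trans rM.
  rewrite (ex (Ordinal jr)) ?subrr// ffunE /= insubT//= => jM.
  by congr (Some (enum_val (maxrankfun M _))); apply: val_inj.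
have /matrixP/(_ 0 0) : row_mx C h%:M *m pt x = 0.
  by rewrite CM -mulmxA Mx mulmx0.
rewrite mul_row_col mul_mx_scalar scaleN1r !mxE eqxx mulr1n => /eqP.
by rewrite subr_eq0 => /eqP.
Qed.

(** Each facet is lifted to a family of affinely independent points above it and
encoded by [face_code].  If two facets have the same code, the inequality of
each is tight at the points of the other; the last hypothesis then makes the
code injective. *)
Lemma card_facets_formulation (R : realType) (d : nat) (P : set 'cV[R]_d)
    (F : formulation P) (J S : finType) (C : J -> 'rV[R]_d) (h : J -> R)
    (p : J -> S -> 'cV[R]_d) :
  (forall j x, P x -> (C j *m x) 0 0 <= h j) ->
  (forall j s, P (p j s)) -> (forall j s, (C j *m p j s) 0 0 = h j) ->
  (forall j, affinely_independent (p j)) -> (0 < #|S|)%N -> #|S| = d ->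
  (forall i j, (forall s, (C j *m p i s) 0 0 = h j) -> i = j) ->
  (#|J| <= (form_size F).+1 ^ (form_vars F).+1)%N.
Proof.
case: F => m f A b [/= _ PQ] CP Pp Cp indep S0 Sd sep.
have /choice[y Qy] : forall js : J * S, exists y : 'cV[R]_m,
    polyhedron A b (col_mx (p js.1 js.2) y).
  by move=> [j s]; have := Pp j s; rewrite {1}PQ.
pose z j s := col_mx (p j s) (y (j, s)).
pose CC j := row_mx (C j) (0 : 'rV_m).
have CCE j (w : 'cV_(d + m)) : (CC j *m w) 0 0 = (C j *m usubmx w) 0 0.
  by rewrite -{1}(vsubmxK w) mul_row_col mul0mx addr0.
have code j : exists e : {ffun 'I_m.+1 -> option 'I_f},
    (forall s a i, e a = Some i -> (A *m z j s) i 0 = b i 0) /\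
    forall w : 'cV[R]_(d + m),
      (forall a i, e a = Some i -> (A *m w) i 0 = b i 0) ->
      (CC j *m w) 0 0 = h j.
  apply: face_code => //; last by rewrite Sd addnS.
  - move=> w Qw; rewrite CCE; apply: CP; rewrite PQ; exists (dsubmx w).
    by rewrite vsubmxK.
  - by move=> s; exact: (Qy (j, s)).
  - by move=> s; rewrite CCE col_mxKu.
  - move=> u u0 uz; apply: (indep j) => //.
    transitivity (usubmx (\sum_s u s *: z j s)); last by rewrite uz linear0.
    by rewrite linear_sum; apply: eq_bigr => s _; rewrite linearZ/= col_mxKu.
have /choice[e eP] := code.
have e_inj : injective e.
  move=> i j eij; apply: sep => s.
  have := (eP j).2 (z i s); rewrite CCE col_mxKu; apply => a l.
  by rewrite -eij; apply: (eP i).1.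
by have := leq_card e e_inj; rewrite card_ffun card_option !card_ord.
Qed.

(** * Two polytopes whose union has a hull with many facets *)

Lemma sum_option (V : zmodType) (T : finType) (g : option T -> V) :
  \sum_s g s = g None + \sum_a g (Some a).
Proof.
rewrite (bigD1 None)//= (reindex_omap Some id)//=; last by case.
by congr (_ + _); apply: eq_bigl => a; rewrite eqxx.
Qed.

Definition cayley_point (R : realType) (k : nat) (x y : 'I_k -> R) (t : R) :
  'cV[R]_(k + k + 1) := col_mx (col_mx (\col_i x i) (\col_i y i)) t%:M.

Definition cayley_form (R : realType) (k : nat) (a b : 'I_k -> R) (c : R) :
  'rV[R]_(k + k + 1) := row_mx (row_mx (\row_i a i) (\row_i b i)) c%:M.

Lemma cayley_pointP (R : realType) (k : nat) (z : 'cV[R]_(k + k + 1)) :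
  exists x y t, z = cayley_point x y t.
Proof.
exists (fun i => z (lshift 1 (lshift k i)) 0).
exists (fun i => z (lshift 1 (rshift k i)) 0), (z (rshift (k + k) 0) 0).
apply/colP => i; case: (split_ordP i) => [j ->|j ->]; last first.
  by rewrite col_mxEd (ord1 j) mxE eqxx.
by rewrite col_mxEu; case: (split_ordP j) => [l ->|l ->];
  rewrite ?col_mxEu ?col_mxEd mxE.
Qed.

Lemma cayley_formE (R : realType) (k : nat) (a b x y : 'I_k -> R) (c t : R) :
  (cayley_form a b c *m cayley_point x y t) 0 0 =
  \sum_i (a i * x i + b i * y i) + c * t.
Proof.
rewrite !mul_row_col -scalar_mxM mxE.
rewrite [X in X + _]mxE [X in _ + X]mxE eqxx mulr1n.
rewrite !mxE -big_split/=; congr (_ + _); apply: eq_bigr => i _.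
by rewrite !mxE.
Qed.

Lemma cayley_point_boxP (R : realType) (k : nat)
    (x1 x x2 y1 y y2 : 'I_k -> R) (t1 t t2 : R) :
  (forall i, cayley_point x1 y1 t1 i 0 <= cayley_point x y t i 0
    <= cayley_point x2 y2 t2 i 0) <->
  [/\ forall i, x1 i <= x i <= x2 i, forall i, y1 i <= y i <= y2 i &
    t1 <= t <= t2].
Proof.
split=> [xyt|[xP yP tP] i].
  split=> [i|i|].
  - by have := xyt (lshift 1 (lshift k i)); rewrite !col_mxEu !mxE.
  - by have := xyt (lshift 1 (rshift k i)); rewrite !col_mxEu !col_mxEd !mxE.
  - by have := xyt (rshift (k + k) 0); rewrite !col_mxEd !mxE eqxx !mulr1n.
case: (split_ordP i) => [j ->|j ->]; last first.
  by rewrite !col_mxEd (ord1 j) !mxE eqxx.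
by rewrite !col_mxEu; case: (split_ordP j) => [l ->|l ->];
  rewrite ?col_mxEu ?col_mxEd !mxE.
Qed.

Lemma sum_delta (R : realType) (k : nat) (g : 'I_k -> R) (a : 'I_k) :
  \sum_i g i * (i == a)%:R = g a.
Proof.
rewrite (bigD1 a)//= eqxx mulr1 big1 ?addr0// => i /negPf->.
by rewrite mulr0.
Qed.

(** The product of [k] polygons bounded above by the tangents of the parabola
[y = - x ^ 2] at the points [0, 1, ..., n - 1]; the box keeps it bounded and is
large enough to contain an open piece of every tangent edge. *)
Definition parabola_product (R : realType) (k n : nat) :
    set 'cV[R]_(k + k + 1) :=
  boxed (cayley_point (fun=> - n%:R ^+ 2) (fun=> - n%:R ^+ 2) 0)
    (cayley_point (fun=> n%:R ^+ 2) (fun=> n%:R ^+ 2) 0)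
    (fun ij : 'I_k * 'I_n => cayley_form
      (fun i => ij.2%:R *+ 2 * (i == ij.1)%:R)
      (fun i => (i == ij.1)%:R) 0)
    (fun ij => ij.2%:R ^+ 2).

(** The vertex [0] keeps this polytope nonempty when [k = 0]. *)
Definition corner_simplex (R : realType) (k : nat) : set 'cV[R]_(k + k + 1) :=
  boxed (cayley_point (fun=> 0) (fun=> 0) 1)
    (cayley_point (fun=> 0) (fun=> 1) 1)
    (fun _ : unit => cayley_form (fun=> 0) (fun=> 1) 0) (fun=> 1).

Lemma parabola_productP (R : realType) (k n : nat) (x y : 'I_k -> R) (t : R) :
  parabola_product n (cayley_point x y t) <->
  [/\ forall i, `|x i| <= n%:R ^+ 2, forall i, `|y i| <= n%:R ^+ 2, t = 0 &
    forall i (j : 'I_n), j%:R *+ 2 * x i + y i <= j%:R ^+ 2].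
Proof.
have lE i (j : 'I_n) : (cayley_form (fun i' => j%:R *+ 2 * (i' == i)%:R)
      (fun i' => (i' == i)%:R) 0 *m cayley_point x y t) 0 0 =
    j%:R *+ 2 * x i + y i.
  rewrite cayley_formE mul0r addr0.
  rewrite -[RHS](sum_delta (fun i => j%:R *+ 2 * x i + y i)).
  by apply: eq_bigr => l _; ring.
split=> [[/cayley_point_boxP[xn yn t0] hij]|[xn yn t0 hij]].
  split=> [i|i||i j].
  - by rewrite ler_norml.
  - by rewrite ler_norml.
  - by apply/le_anti; rewrite andbC.
  - by have := hij (i, j); rewrite lE.
split.
  by apply/cayley_point_boxP; split=> [i|i|]; rewrite ?t0 ?lexx// -ler_norml.
by move=> [i j]; rewrite lE.
Qed.

Lemma corner_simplexP (R : realType) (k : nat) (x y : 'I_k -> R) (t : R) :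
  corner_simplex (cayley_point x y t) <->
  [/\ forall i, x i = 0, forall i, 0 <= y i <= 1, t = 1 & \sum_i y i <= 1].
Proof.
have lE : (cayley_form (fun=> 0) (fun=> 1) 0 *m cayley_point x y t) 0 0 =
    \sum_i y i.
  by rewrite cayley_formE mul0r addr0; apply: eq_bigr => i _; ring.
split=> [[/cayley_point_boxP[x0 y01 t1] /(_ tt)]|[x0 y01 t1 ys]]; rewrite ?lE => *.
  by split=> // [i|]; apply/le_anti; rewrite andbC.
split=> [|_]; rewrite ?lE//; apply/cayley_point_boxP.
by split=> [i|i|]; rewrite ?x0 ?t1 ?lexx.
Qed.

(** The points indexed by [None] and [inl] span the product of the edges selected
by [J]: the points of tangency, and a move of length 1/2 along one edge.  Half a
unit is where the tangents at consecutive integers meet, hence still on the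
edge. *)
Definition facet_point (R : realType) (k n : nat) (J : {ffun 'I_k -> 'I_n})
    (s : option ('I_k + 'I_k)) : 'cV[R]_(k + k + 1) :=
  match s with
  | None => cayley_point (fun i => (J i)%:R) (fun i => - (J i)%:R ^+ 2) 0
  | Some (inl a) => cayley_point (fun i => (J i)%:R + (i == a)%:R / 2)
      (fun i => - (J i)%:R ^+ 2 - (J i)%:R * (i == a)%:R) 0
  | Some (inr a) => cayley_point (fun=> 0) (fun i => (i == a)%:R) 1
  end.

(** The coefficient of [t] lifts the bound 1 over the simplex to the maximum
[facet_max] over the product of polygons. *)
Definition facet_form (R : realType) (k n : nat) (J : {ffun 'I_k -> 'I_n}) :
  'rV[R]_(k + k + 1) :=
  cayley_form (fun i => (J i)%:R *+ 2) (fun=> 1) (\sum_i (J i)%:R ^+ 2 - 1).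

Definition facet_max (R : realType) (k n : nat) (J : {ffun 'I_k -> 'I_n}) : R :=
  \sum_i (J i)%:R ^+ 2.

Lemma facet_form_le (R : realType) (k n : nat) (J : {ffun 'I_k -> 'I_n})
    (z : 'cV[R]_(k + k + 1)) :
  (parabola_product n `|` @corner_simplex R k) z ->
  (facet_form R J *m z) 0 0 <= facet_max R J.
Proof.
have [x [y [t ->]]] := cayley_pointP z; rewrite cayley_formE.
move=> [/parabola_productP[_ _ -> hij]|/corner_simplexP[x0 _ -> ys]].
  by rewrite mulr0 addr0; apply: ler_sum => i _; rewrite mul1r; apply: hij.
rewrite /facet_max mulr1.
under eq_bigr do rewrite x0 mulr0 add0r mul1r.
lra.
Qed.

Lemma facet_point_in (R : realType) (k n : nat) (J : {ffun 'I_k -> 'I_n}) s :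
  (parabola_product n `|` @corner_simplex R k) (facet_point R J s).
Proof.
have Jn i : (J i)%:R + 1 <= n%:R :> R by rewrite natr1 ler_nat.
have J0 i : 0 <= (J i)%:R :> R by [].
have Jsq i : 0 <= (J i)%:R ^+ 2 :> R by exact: sqr_ge0.
have Jnsq i : ((J i)%:R + 1) ^+ 2 <= n%:R ^+ 2 :> R.
  by rewrite lerXn2r ?nnegrE ?addr_ge0.
have Jj i (j : 'I_n) : j%:R <= (J i)%:R :> R \/ (J i)%:R + 1 <= j%:R :> R.
  by rewrite natr1 !ler_nat; case: (leqP j (J i)) => ?; [left|right].
case: s => [[a|a]|].
- left; apply/parabola_productP; split=> // [i|i|i j].
  + have := Jnsq i; have := Jsq i; have := J0 i.
    by rewrite ler_norml => *; case: (i == a) => /=; apply/andP; split; lra.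
  + have := Jnsq i; have := Jsq i; have := J0 i.
    by rewrite ler_norml => *; case: (i == a) => /=; apply/andP; split; lra.
  + have := sqr_ge0 (j%:R - (J i)%:R : R).
    (* On the moved coordinate the slack is [(j - J i) ^ 2 - (j - J i)], which is
    nonnegative because [j - J i] is an integer. *)
    case: (i == a) => /=; last by nra.
    have := Jj i j => -[]; nra.
- right; apply/corner_simplexP; split=> // [i|].
    by rewrite ler0n lern1 leq_b1.
  by under eq_bigr do rewrite -[_%:R]mul1r; rewrite sum_delta.
- left; apply/parabola_productP; split=> // [i|i|i j].
  + by have := Jnsq i; have := Jsq i; have := J0 i;
      rewrite ler_norml => *; apply/andP; split; lra.
  + by have := Jnsq i; have := Jsq i; have := J0 i;
      rewrite ler_norml => *; apply/andP; split; lra.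
  + by have := sqr_ge0 (j%:R - (J i)%:R : R); nra.
Qed.

Lemma facet_point_tight (R : realType) (k n : nat) (J : {ffun 'I_k -> 'I_n}) s :
  (facet_form R J *m facet_point R J s) 0 0 = facet_max R J.
Proof.
case: s => [[a|a]|]; rewrite cayley_formE ?mulr0 ?addr0.
- by apply: eq_bigr => i _; field.
- under eq_bigr do rewrite mulr0 add0r.
  by rewrite sum_delta /facet_max; ring.
- by apply: eq_bigr => i _; ring.
Qed.

(** The slack of the inequality of [J] at the points of tangency of [I] is the
sum of the squares of the [J i - I i]. *)
Lemma facet_point_separated (R : realType) (k n : nat)
    (I J : {ffun 'I_k -> 'I_n}) :
  (facet_form R J *m facet_point R I None) 0 0 = facet_max R J -> I = J.
Proof.
rewrite cayley_formE mulr0 addr0 /facet_max => /eqP.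
rewrite eq_sym -subr_eq0 -sumrB.
have -> : \sum_i
      ((J i)%:R ^+ 2 - ((J i)%:R *+ 2 * (I i)%:R + 1 * - (I i)%:R ^+ 2))
    = \sum_i ((J i)%:R - (I i)%:R) ^+ 2 :> R by apply: eq_bigr => i _; ring.
rewrite psumr_eq0 => [/allP IJ|i _]; last exact: sqr_ge0.
apply/ffunP => i; have := IJ i (mem_index_enum i).
rewrite sqrf_eq0 subr_eq0 eqr_nat => /eqP IJi.
by apply: val_inj.
Qed.

(** The coordinate [t] kills the total weight of the simplex points; then the
coordinates [x] isolate the moves along the edges, and the coordinates [y] the
simplex points. *)
Lemma facet_point_indep (R : realType) (k n : nat) (J : {ffun 'I_k -> 'I_n}) :
  affinely_independent (facet_point R J).
Proof.
move=> u.
have sumE (g : option ('I_k + 'I_k) -> R) : \sum_s g s =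
    g None + (\sum_a g (Some (inl a)) + \sum_a g (Some (inr a))).
  by rewrite sum_option big_sumType.
rewrite sumE => u0 up.
have upi i : \sum_s u s * facet_point R J s i 0 = 0.
  have /colP/(_ i) := up; rewrite summxE [RHS]mxE => upi; rewrite -{2}upi.
  by apply: eq_bigr => s _; rewrite mxE.
have uR : \sum_a u (Some (inr a)) = 0.
  have := upi (rshift (k + k) 0); rewrite sumE/= !col_mxEd !mxE mulr0 add0r.
  under eq_bigr do rewrite !col_mxEd !mxE mulr0.
  under [X in _ + X]eq_bigr do rewrite !col_mxEd !mxE mulr1.
  by rewrite sumr_const mul0rn add0r.
have uL a : u (Some (inl a)) = 0.
  have := upi (lshift 1 (lshift k a)); rewrite sumE/= !col_mxEu !mxE.
  under eq_bigr do rewrite !col_mxEu !mxE mulrDr mulrA eq_sym.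
  under [X in _ + (_ + X)]eq_bigr do rewrite !col_mxEu !mxE mulr0.
  rewrite big_split/= -!mulr_suml sum_delta sumr_const mul0rn.
  rewrite uR addr0 in u0.
  have -> : \sum_i u (Some (inl i)) = - u None
    by apply/eqP; rewrite -addr_eq0 addrC u0.
  rewrite mulNr addr0 addNKr => /eqP.
  by rewrite mulf_eq0 invr_eq0 pnatr_eq0 orbF => /eqP.
have uN : u None = 0.
  by move: u0; rewrite uR big1 ?addr0.
case=> [[a|a]|] //.
have := upi (lshift 1 (rshift k a)); rewrite sumE/= uN mul0r add0r.
rewrite big1 ?add0r => [|i _]; last by rewrite uL mul0r.
under eq_bigr do rewrite !col_mxEu col_mxEd mxE eq_sym.
by rewrite sum_delta.
Qed.

Lemma parabola_corner_union (R : realType) (k n : nat) :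
  exists (P1 P2 : set 'cV[R]_(k + k + 1))
    (F1 : formulation P1) (F2 : formulation P2),
    [/\ polytope P1, polytope P2, P1 !=set0, P2 !=set0 &
      (form_size F1 + form_size F2 = 8 * k + 5 + k * n)%N /\
      forall F : formulation (convex_hull (P1 `|` P2)),
        (n ^ k <= (form_size F).+1 ^ (form_vars F).+1)%N].
Proof.
have [pol1 [F1 sF1]] : polytope (@parabola_product R k n) /\
  exists F : formulation (@parabola_product R k n), form_size F = _
  := boxed_formulation _ _ _ _.
have [pol2 [F2 sF2]] : polytope (@corner_simplex R k) /\
  exists F : formulation (@corner_simplex R k), form_size F = _
  := boxed_formulation _ _ _ _.
exists (@parabola_product R k n), (@corner_simplex R k), F1, F2; split => //.
- exists (cayley_point (fun=> 0) (fun=> 0) 0); apply/parabola_productP.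
  by split=> // [i|i|i j]; rewrite ?normr0 ?mulr0 ?addr0.
- exists (cayley_point (fun=> 0) (fun=> 0) 1); apply/corner_simplexP.
  by split=> // [i|]; rewrite ?lexx ?ler01// big1.
split=> [|F].
  by rewrite sF1 sF2 card_prod !card_ord card_unit; lia.
have := @card_facets_formulation _ _ _ F {ffun 'I_k -> 'I_n}
  (option ('I_k + 'I_k)) (@facet_form R k n) (@facet_max R k n)
  (@facet_point R k n).
rewrite card_ffun !card_ord; apply.
- move=> J x; apply: (@smallest_sub _ _ _ [set z | _ <= _]).
    exact: convex_halfspace.
  by move=> z; exact: facet_form_le.
- by move=> J s; apply: sub_gen_smallest; exact: facet_point_in.
- exact: facet_point_tight.
- exact: facet_point_indep.
- by rewrite card_option.
- by rewrite card_option card_sum !card_ord addn1.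
- by move=> I J IJ; apply: facet_point_separated.
Qed.

(** * Choosing the number of tangents *)

Lemma horner_le_expn (R : realType) (p : {poly R}) (x : R) :
  1 <= x -> p.[x] <= (\sum_(i < size p) `|p`_i|) * x ^+ size p.
Proof.
move=> x1; rewrite horner_coef mulr_suml; apply: ler_sum => i _.
apply: le_trans (ler_norm _) _; rewrite normrM ler_wpM2l//.
rewrite ger0_norm ?exprn_ge0 ?(le_trans ler01)//.
by apply: ler_weXn2l => //; apply: ltnW.
Qed.

(** The exponent does not depend on [a] and [b]: for large [n] the linear
function [a + b * n] is at most [n ^ 2], and one more power of [n] absorbs the
coefficients of [p]. *)
Lemma polynomially_bounded_size (R : realType) (p : {poly R}) (a b : nat) :
  (0 < a)%N -> exists2 n : nat, (1 < n)%N & forall f : nat,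
    f%:R <= p.[(a + b * n)%:R] -> (f.+1 <= n ^ (2 * size p).+1)%N.
Proof.
move=> a0; pose K := Num.truncn (\sum_(i < size p) `|p`_i|).
have KP : \sum_(i < size p) `|p`_i| <= K.+1%:R.
  by apply: ltW; rewrite truncnS_gt.
pose n := (K + a + b + 3)%N.
exists n => [|f fp]; first by rewrite /n; lia.
have n0 : (0 < n)%N by rewrite /n; lia.
have : (f <= K.+1 * n ^ (2 * size p))%N.
  rewrite -(ler_nat R); apply: le_trans fp _.
  apply: le_trans (horner_le_expn _ _) _; first by rewrite ler1n addn_gt0 a0.
  rewrite natrM; apply: ler_pM => //; first exact: sumr_ge0.
  rewrite expnM natrX lerXn2r ?nnegrE ?ler0n// ler_nat /n; nia.
have : (0 < n ^ (2 * size p))%N by rewrite expn_gt0 n0.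
rewrite expnS /n; nia.
Qed.

Theorem theorem2 (R : realType) (sigma : {poly R}) :
  exists (c : R) (d0 : nat), 0 < c /\
    forall d : nat, odd d ->
      exists (P1 P2 : set 'cV[R]_d) (F1 : formulation P1) (F2 : formulation P2),
        [/\ polytope P1, polytope P2, P1 !=set0, P2 !=set0 &
          forall F : formulation (convex_hull (P1 `|` P2)),
            (form_size F)%:R <= sigma.[(form_size F1 + form_size F2)%:R] ->
            (d0 <= d)%N ->
            c * d%:R <= (form_vars F)%:R].
Proof.
pose e := (2 * size sigma).+1.
exists (4 * e)%:R^-1, (4 * e + 2)%N; split.
  by rewrite invr_gt0 ltr0n.
move=> d d_odd.
have [k ->] : exists k, d = (k + k + 1)%N.
  by exists d./2; rewrite addn1 addnn -[LHS]odd_double_half d_odd.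
have [|n n1 nP] := @polynomially_bounded_size R sigma (8 * k + 5) k.
  by rewrite addnS.
have [P1 [P2 [F1 [F2 [pol1 pol2 ne1 ne2 [sizeF facets]]]]]] :=
  parabola_corner_union R k n.
exists P1, P2, F1, F2; split => // F; rewrite sizeF => /nP sizeFn d0.
have ke : (k <= e * (form_vars F).+1)%N.
  rewrite -(leq_exp2l _ _ n1) expnM; apply: leq_trans (facets F) _.
  by rewrite leq_exp2r.
rewrite mulrC ler_pdivrMr ?ltr0n// -natrM ler_nat; nia.
Qed.
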